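(* Let $(A,S)$ be a weighted quiver with potential, with underlying weighted quiver $(Q,wt)$ having no loops or oriented 2-cycles, let $k\in Q_0$, and let $(Q',wt')$ be the underlying weighted quiver of the mutated weighted quiver with potential $\mu_k(A,S)$. Then $\mu_k(Q,wt)$ is the weight reduction of $(Q',wt')$. In particular, $(Q',wt')=\mu_k(Q,wt)$ (up to isomorphism of weighted quivers) in the special case when $Q'$ has no oriented 2-cycles.
   Context: Let $G$ be a group and $Q=(Q_0,Q_1,wt)$ a finite quiver without loops with weight function $wt:Q_1\to G$. $R=\mathbb C^{Q_0}$ is the semisimple algebra with idempotents $e_i$, $A=\mathbb C^{Q_1}=\bigoplus_g A_g$ is the arrow span ($A_g$ spanned by the arrows of weight $g$), an $R$-bimodule with $e_iAe_j$ spanned by the arrows $i\to j$ (left-to-right composition). $R\langle\langle A\rangle\rangle=\prod_{d\ge0}A^d$, $A^d=A^{\otimes_R d}$, is the completed path algebra. The weight of a path is the product of the weights of its arrows in order. A potential is a (possibly infinite) linear combination of oriented cycles of weight $1$. Two potentials are cyclically equivalent if their difference lies in the closure of the span of the elements $a_1\cdots a_d-a_2\cdots a_da_1$, with $a_1\cdots a_d$ a cyclic path. A weighted quiver with potential $(A,S)$ is such a weighted quiver (with arrow span $A$) with a potential $S$ no two terms of which are cyclically equivalent up to scalar. Weighted quiver mutation. For $(Q,wt)$ without loops or oriented 2-cycles, $\tilde\mu_k(Q,wt)=(\tilde Q,\tilde{wt})$ is obtained by adding an arrow $[ab]:i\to j$ of weight $wt(a)wt(b)$ for each pair $a:i\to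 k$, $b:k\to j$, and then replacing each arrow $x$ into or out of $k$ by a reversed arrow $x^\ast$ of weight $wt(x)^{-1}$. Weight reduction of a weighted quiver means repeatedly removing pairs of arrows $a:i\to j$, $b:j\to i$ with $wt(a)wt(b)=1$ until none remain (well defined up to isomorphism). $\mu_k(Q,wt)$ is the weight reduction of $(\tilde Q,\tilde{wt})$. Trivial and reduced parts. For a weighted quiver with potential $(B,T)$ with vertices $\{1,\dots,n\}$, the degree $2$ part $T^{(2)}$ is, up to cyclic equivalence, a sum of elements $T_g^{ij}\in e_iB_ge_j\otimes e_jB_{g^{-1}}e_i$ ($i<j$, $g\in G$); let $V_g^{ij}\subseteq e_iB_ge_j$ and $V_{g^{-1}}^{ji}\subseteq e_jB_{g^{-1}}e_i$ be the images of the linear maps $(e_jB_{g^{-1}}e_i)^\ast\to e_iB_ge_j$ and $(e_iB_ge_j)^\ast\to e_jB_{g^{-1}}e_i$ induced by $T_g^{ij}$. Put $B_{triv}=\bigoplus_{i<j,g}(V_g^{ij}\oplus V_{g^{-1}}^{ji})$, $T_{triv}=T^{(2)}$, $B_{red}=B/B_{triv}$. Up to a $G$-graded automorphism of $R\langle\langle B\rangle\rangle$ that is the identity on $R$ and identity modulo paths of length $\ge2$, and up to cyclic equivalence, $(B,T)$ decomposes as $(B_{triv},T_{triv})\oplus(B_{red},T_{red})$ with $T_{red}$ having only terms of degree $\ge3$. The underlying weighted quiver of $(B_{red},T_{red})$ has exactly $\dim e_i(B_{red})_ge_j$ arrows $i\to j$ of weight $g$. Mutation of a weighted quiver with potential.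 Let $(A,S)$ have underlying weighted quiver $(Q,wt)$ without loops or oriented 2-cycles, and $k\in Q_0$. Let $\tilde A$ be the arrow span of $(\tilde Q,\tilde{wt})=\tilde\mu_k(Q,wt)$, and $\tilde S=[S]+\Delta_k$, where $[S]$ is obtained from $S$, written up to cyclic equivalence as a combination of cyclic paths not starting or ending at $k$, by replacing each pair of consecutive arrows $a:i\to k$, $b:k\to j$ in a path by $[ab]$, and $\Delta_k=\sum a^\ast[ab]b^\ast$, summed over all pairs of arrows $a$ into $k$ and $b$ out of $k$. All terms of $\tilde S$ have weight $1$. Then $\mu_k(A,S)=(\tilde A_{red},\tilde S_{red})$, with underlying weighted quiver denoted $(Q',wt')$. *)

(* Defs.v *)
From HB Require Import structures.
From mathcomp Require Import all_boot all_order all_fingroup all_algebra.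
From mathcomp Require Import functions.

Set Implicit Arguments.
Unset Strict Implicit.
Unset Printing Implicit Defensive.

Import GRing.Theory.
Local Open Scope ring_scope.

(* The vertex type V stays fixed throughout: mutation and reduction only
   change the arrows, so that all path algebras have the same semisimple
   part R = C^V. *)
Record wquiver (G : groupType) (V : finType) := WQuiver {
  arrow : finType;
  src : arrow -> V;
  tgt : arrow -> V;
  wt : arrow -> G }.

Section WeightedQuivers.
Variables (G : groupType) (V : finType).
Implicit Types (Q P : wquiver G V) (k : V).

Definition no_loops Q := forall a : arrow Q, src a <> tgt a.

Definition no_2cycles Q := forall a b : arrow Q,
  ~ [/\ src a <> tgt a, tgt a = src b & tgt b = src a].

Definition wq_iso Q P := exists f : arrow Q -> arrow P,
  [/\ bijective f,
      forall a, src (f a) = src a,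
      forall a, tgt (f a) = tgt a &
      forall a, wt (f a) = wt a].

Definition cancelling Q (a b : arrow Q) :=
  [/\ a <> b, tgt a = src b, tgt b = src a & (wt a * wt b = 1)%g].

Definition wq_del Q (a b : arrow Q) : wquiver G V :=
  @WQuiver G V {x : arrow Q | x \notin [:: a; b]}
    (fun x => src (val x)) (fun x => tgt (val x)) (fun x => wt (val x)).

Inductive reduces_to : wquiver G V -> wquiver G V -> Prop :=
| reduces_stop Q :
    (forall a b : arrow Q, ~ cancelling a b) -> reduces_to Q Q
| reduces_step Q (a b : arrow Q) P :
    cancelling a b -> reduces_to (wq_del a b) P -> reduces_to Q P.

(* P is "the" weight reduction of Q, which is defined up to isomorphism. *)
Definition weight_reduction Q P :=
  exists2 P0, reduces_to Q P0 & wq_iso P0 P.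

Definition incident Q k (x : arrow Q) := (src x == k) || (tgt x == k).

Definition through_at Q k : pred (arrow Q * arrow Q) :=
  fun ab => (tgt ab.1 == k) && (src ab.2 == k).
Local Notation through Q k := {ab : arrow Q * arrow Q | @through_at Q k ab}.

(* Arrows of the pre-mutation: [inl x] is x itself when x is not incident to
   k and is x^* otherwise; [inr (a, b)] is the composite arrow [ab]. *)
Definition premut_src Q k (x : arrow Q + through Q k) : V :=
  match x with
  | inl x => if incident k x then tgt x else src x
  | inr ab => src (val ab).1
  end.

Definition premut_tgt Q k (x : arrow Q + through Q k) : V :=
  match x with
  | inl x => if incident k x then src x else tgt x
  | inr ab => tgt (val ab).2
  end.

Definition premut_wt Q k (x : arrow Q + through Q k) : G :=
  match x with
  | inl x => if incident k x then ((wt x)^-1)%g else wt x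
  | inr ab => (wt (val ab).1 * wt (val ab).2)%g
  end.

Definition wq_premut k Q : wquiver G V :=
  @WQuiver G V (arrow Q + through Q k)%type
    (@premut_src Q k) (@premut_tgt Q k) (@premut_wt Q k).

(* P = mu_k(Q), up to isomorphism. *)
Definition wq_mutation k Q P := weight_reduction (wq_premut k Q) P.

End WeightedQuivers.

Notation through Q k :=
  {ab : arrow Q * arrow Q | through_at k ab}.

Section Paths.
Variables (G : groupType) (V : finType) (Q : wquiver G V).

Fixpoint walk (i : V) (s : seq (arrow Q)) : bool :=
  if s is a :: s' then (src a == i) && walk (tgt a) s' else true.

(* A path is its starting vertex together with its arrows, composed from left
   to right; (i, [::]) is the trivial path e_i. *)
Record qpath := QPath {
  pval : V * seq (arrow Q);
  pval_walk : walk pval.1 pval.2 }.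
HB.instance Definition _ := [isSub for pval].
HB.instance Definition _ := [Choice of qpath by <:].

Definition pstart (p : qpath) : V := (pval p).1.
Definition parrows (p : qpath) : seq (arrow Q) := (pval p).2.
Definition walk_end (i : V) (s : seq (arrow Q)) : V := last i [seq tgt a | a <- s].
Definition pend (p : qpath) : V := walk_end (pstart p) (parrows p).
Definition plen (p : qpath) : nat := size (parrows p).
Definition pweight (p : qpath) : G := (\prod_(a <- parrows p) wt a)%g.

Definition is_cycle (p : qpath) := (parrows p != [::]) && (pend p == pstart p).

End Paths.

(* R<<A>> is the product of the A^d, and the paths of length d form a basis of
   A^d: an element is an arbitrary family of coefficients indexed by paths.
   Addition and scaling are the pointwise ones; the product is [pmul] below,
   not the pointwise product of functions. *)
Notation pathalg F Q := (qpath Q -> F).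

Section PathAlgebra.
Variables (F : fieldType) (G : groupType) (V : finType) (Q : wquiver G V).
Implicit Types (f g S T : pathalg F Q) (p q : qpath Q).

Definition mono p : pathalg F Q := fun q => (q == p)%:R.
Definition idem (i : V) : pathalg F Q := fun q => (pval q == (i, [::]))%:R.

(* The coefficient of the path (i, s), and 0 if (i, s) is not a path. *)
Definition coef f (i : V) (s : seq (arrow Q)) : F := oapp f 0 (insub (i, s)).

Definition pmul f g : pathalg F Q := fun p =>
  \sum_(n < (plen p).+1)
     coef f (pstart p) (take n (parrows p)) *
     coef g (walk_end (pstart p) (take n (parrows p))) (drop n (parrows p)).

Definition homogeneous (h : G) f := forall p, f p != 0 -> pweight p = h.

Definition is_potential S :=
  forall p, S p != 0 -> is_cycle p /\ pweight p = 1%g.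

(* The elements a_1 ... a_d - a_2 ... a_d a_1 with a_1 ... a_d cyclic. *)
Definition rot_diff f := exists p q,
  [/\ is_cycle p, parrows q = rot 1 (parrows p) & f = mono p - mono q].

Inductive rot_span : pathalg F Q -> Prop :=
| rot_span0 : rot_span 0
| rot_spanD c f g : rot_diff f -> rot_span g -> rot_span (c \*o f + g).

(* Closure for the topology of R<<A>> whose neighbourhoods of 0 are the
   products of the A^e with e >= d. *)
Definition cyc_eq S T := forall d : nat, exists2 f, rot_span f &
  forall p, (plen p < d)%N -> (S - T) p = f p.

Definition distinct_terms S := forall p q : qpath Q,
  p <> q -> S p != 0 -> S q != 0 ->
  ~ exists2 c : F, c != 0 & cyc_eq (mono p) (c \*o mono q).

Definition deg2 T : pathalg F Q := fun p => if plen p == 2%N then T p else 0.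

(* G-graded automorphisms of R<<A>> that are the identity on R and the
   identity modulo paths of length at least 2. *)
Record unitriangular_aut (phi : pathalg F Q -> pathalg F Q) : Prop := {
  _ : bijective phi;
  _ : forall c f g, phi (c \*o f + g) = c \*o phi f + phi g;
  _ : forall f g, phi (pmul f g) = pmul (phi f) (phi g);
  _ : forall i, phi (idem i) = idem i;
  _ : forall h f, homogeneous h f -> homogeneous h (phi f);
  _ : forall f p, (plen p < 2)%N -> phi f p = f p }.

End PathAlgebra.

Record wqp (F : fieldType) (G : groupType) (V : finType) := WQP {
  quiver : wquiver G V;
  potential : pathalg F quiver;
  _ : is_potential potential;
  _ : distinct_terms potential }.
Arguments potential {F G V} w _.

Section Reduction.
Variables (F : fieldType) (G : groupType) (V : finType) (Q : wquiver G V).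

Definition arrow_span : vectType F := {ffun arrow Q -> F^o}.

Definition arrow_vec (a : arrow Q) : arrow_span := [ffun x => (x == a)%:R].

Definition hom (i j : V) (g : G) : {set arrow Q} :=
  [set a | [&& src a == i, tgt a == j & wt a == g]].

(* e_i B_g e_j *)
Definition span_hom i j g : {vspace arrow_span} :=
  <<[seq arrow_vec a | a <- enum (hom i j g)]>>%VS.

Variable T : pathalg F Q.

(* The coefficient of a (x) b in T_g^{ij}, for a : i -> j and b : j -> i.  The
   cycles ab and ba are cyclically equivalent, so that their coefficients add
   up when T^(2) is brought to its normal form; as this is symmetric in a and
   b, the formula serves for both i < j and j < i and needs no order on V. *)
Definition coef2 (a b : arrow Q) : F :=
  coef T (src a) [:: a; b] + coef T (src b) [:: b; a].

(* The map (e_j B_{g^-1} e_i)^* -> e_i B_g e_j induced by T_g^{ij}; a linear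
   form is given by its values xi b on the arrows b. *)
Definition contract i j (g : G) (xi : arrow_span) : arrow_span :=
  \sum_(a in hom i j g)
     (\sum_(b in hom j i (g^-1)%g) coef2 a b * xi b) *: arrow_vec a.

(* V_g^{ij}, the component e_i (B_triv)_g e_j of the trivial part. *)
Definition triv_part i j g : {vspace arrow_span} :=
  limg (linfun (contract i j g)).

(* iota makes the arrows of Q' a graded basis of B_red = B / B_triv: the
   classes modulo V_g^{ij} of the iota x, for x : i -> j of weight g in Q',
   form a basis of e_i B_g e_j / V_g^{ij}.  In particular Q' has exactly
   dim e_i (B_red)_g e_j arrows i -> j of weight g. *)
Definition red_basis (Q' : wquiver G V) (iota : arrow Q' -> arrow_span) :=
  forall i j g,
    let X :=
      [seq iota x | x <- enum [set x | [&& src x == i, tgt x == j & wt x == g]]]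
    in [/\ free X,
           (triv_part i j g + <<X>> = span_hom i j g)%VS &
           (triv_part i j g :&: <<X>> = 0)%VS].

(* The map R<<B'>> -> R<<B>> induced by a bimodule map iota : B' -> B. *)
Definition induced (Q' : wquiver G V) (iota : arrow Q' -> arrow_span)
    (f : pathalg F Q') : pathalg F Q := fun p =>
  \sum_(s : (plen p).-tuple (arrow Q'))
     coef f (pstart p) s *
     \prod_(xa <- zip s (parrows p)) (iota xa.1 xa.2 : F).

End Reduction.

(* M' is a reduced part (B_red, T_red) of (B, T), where B is the arrow span of
   Q: the lifts iota of the arrows of M' span a complement of B_triv, and
   T_triv = T^(2). *)
Definition reduced_part (F : fieldType) (G : groupType) (V : finType)
    (Q : wquiver G V) (T : pathalg F Q) (M' : wqp F G V) :=
  exists iota : arrow (quiver M') -> arrow_span F Q,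
  exists phi : pathalg F Q -> pathalg F Q,
    [/\ red_basis T iota,
        unitriangular_aut phi,
        cyc_eq (phi T) (deg2 T + induced iota (potential M')) &
        forall p, potential M' p != 0 -> (3 <= plen p)%N].

Section Mutation.
Variables (F : fieldType) (G : groupType) (V : finType).
Variables (Q : wquiver G V) (k : V).

Definition expand (x : arrow (wq_premut k Q)) : seq (arrow Q) :=
  match x with
  | inl x => [:: x]
  | inr ab => [:: (val ab).1; (val ab).2]
  end.

Definition starred (x : arrow (wq_premut k Q)) : bool :=
  if x is inl x then incident k x else false.

(* Substituting [ab] for each factor ab through k is a bijection from the
   paths of Q that neither start nor end at k to the paths of the pre-mutation
   with no starred arrow that neither start nor end at k; its inverse expands
   each [ab] to ab. *)
Definition bracket (S : pathalg F Q) : pathalg F (wq_premut k Q) := fun p =>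
  if has starred (parrows p) then 0
  else coef S (pstart p) (flatten [seq expand x | x <- parrows p]).

(* The sum of the a^* [ab] b^*. *)
Definition Delta : pathalg F (wq_premut k Q) := fun p =>
  \sum_(ab : through Q k)
     (parrows p == [:: inl (val ab).1; inr ab; inl (val ab).2])%:R.

End Mutation.
Arguments bracket {F G V Q} k S _.
Arguments Delta {F G V Q} k _.

Definition wqp_mutation (F : fieldType) (G : groupType) (V : finType) (k : V)
    (M M' : wqp F G V) :=
  exists S : pathalg F (quiver M),
    [/\ cyc_eq (potential M) S,
        is_potential S,
        forall p, S p != 0 -> pstart p <> k &
        reduced_part (bracket k S + Delta k) M'].

(* Main.v *)
From HB Require Import structures.
Require Import Defs.
From mathcomp Require Import all_boot all_order all_fingroup all_algebra.
From mathcomp Require Import reals complex.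

Set Implicit Arguments.
Unset Strict Implicit.
Unset Printing Implicit Defensive.

Import GRing.Theory.
Local Open Scope ring_scope.

Local Notation arrows := Defs.hom.

(** Up to isomorphism a weighted quiver is the family of numbers n(i,j,g) of
    its arrows i -> j of weight g.  Weight reduction removes an arrow counted
    by n(i,j,g) together with one counted by n(j,i,g^-1), so it preserves the
    excess n(i,j,g) - n(j,i,g^-1), truncated at 0; and once no cancelling pair
    is left, one of the two numbers is 0, so that n(i,j,g) is the excess
    ([card_hom_reduces_to]).  Hence quivers without loops that have the same
    excess have isomorphic weight reductions.

    It remains to compare the pre-mutation with the underlying quiver of the
    mutated potential.  Passing to the reduced part replaces n(i,j,g) by
    n(i,j,g) - dim V_g^{ij} ([card_hom_red_basis]).  The spaces V_g^{ij} and
    V_{g^-1}^{ji} are the images of two adjoint maps, which have the same rank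
    ([dim_triv_part_sym]): the same number is subtracted from n(i,j,g) and from
    n(j,i,g^-1), and the excess does not change.

    When the mutated quiver has no oriented 2-cycle, it has no cancelling pair
    and is its own weight reduction. *)

(** * Maps between finite types with prescribed fibers *)

(** The n-th element of each fiber of [f] is sent to the n-th element of the
    corresponding fiber of [g]. *)
Lemma fiber_injection (I J : finType) (K : eqType) (f : I -> K) (g : J -> K) :
  (forall c, #|[pred x | f x == c]| <= #|[pred y | g y == c]|)%N ->
  exists2 h : I -> J, injective h & forall x, g (h x) = f x.
Proof.
move=> le_fg; case: (pickP (fun _ : I => true)) => [x0 _ | I0]; last first.
  by exists (fun x => False_rect J (notF (esym (I0 x)))) => x; have:= I0 x.
have y0 : J.
  have: (0 < #|[pred y | g y == f x0]|)%N.
    by apply: leq_trans (le_fg _); apply/card_gt0P; exists x0; rewrite inE.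
  by case/card_gt0P/sigW.
pose X c := enum [pred x | f x == c]; pose Y c := enum [pred y | g y == c].
pose h x := nth y0 (Y (f x)) (index x (X (f x))).
have memX x : x \in X (f x) by rewrite mem_enum inE.
have ltY x : (index x (X (f x)) < size (Y (f x)))%N.
  by rewrite -cardE; apply: leq_trans (le_fg _); rewrite cardE index_mem.
have gh x : g (h x) = f x.
  by have:= mem_nth y0 (ltY x); rewrite mem_enum inE => /eqP.
exists h => // x y eq_h.
have eq_f : f x = f y by rewrite -!gh eq_h.
have:= ltY x; have:= memX x; move: eq_h; rewrite /h eq_f => eq_h Xx lt_x.
have:= (nth_uniq y0 lt_x (ltY y) (enum_uniq _)).
by rewrite eq_h eqxx => /esym/eqP/index_inj->.
Qed.

(** Injections in both directions make either of them bijective, by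
    finiteness. *)
Lemma fiber_bijection (I J : finType) (K : eqType) (f : I -> K) (g : J -> K) :
  (forall c, #|[pred x | f x == c]| = #|[pred y | g y == c]|) ->
  exists2 h : I -> J, bijective h & forall x, g (h x) = f x.
Proof.
move=> eq_fg.
have [|h h_inj gh] := @fiber_injection I J K f g.
  by move=> c; rewrite eq_fg.
have [|h' h'_inj _] := @fiber_injection J I K g f.
  by move=> c; rewrite eq_fg.
by exists h => //; apply: inj_card_bij h_inj (leq_card h' h'_inj).
Qed.

(** * The numerical invariant of weight reduction *)

Section WeightReduction.
Variables (G : groupType) (V : finType).
Implicit Types (Q P : wquiver G V) (i j : V) (g : G).

(** The subtraction is truncated: of the two excesses of a pair of opposite
    types (i, j, g) and (j, i, g^-1), at most one is nonzero. *)
Definition excess Q i j g := (#|arrows Q i j g| - #|arrows Q j i (g^-1)%g|)%N.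

Lemma card_hom_loop Q i g : no_loops Q -> #|arrows Q i i g| = 0%N.
Proof.
move=> nlQ; apply: eq_card0 => a; rewrite inE.
by apply/negP => /and3P[/eqP si /eqP ti _]; case: (nlQ a); rewrite si ti.
Qed.

Lemma no_loops_card_hom Q :
  (forall i g, #|arrows Q i i g| = 0%N) -> no_loops Q.
Proof.
move=> hom0 a eq_st; have:= hom0 (src a) (wt a).
by move/card0_eq/(_ a); rewrite !inE eqxx -eq_st !eqxx.
Qed.

(** The bijection is glued from bijections between the fibers of the map that
    sends an arrow to its source, target and weight. *)
Lemma eq_hom_iso Q P : (forall i j g, #|arrows Q i j g| = #|arrows P i j g|) ->
  wq_iso Q P.
Proof.
move=> eq_hom.
pose key X (a : arrow X) := (@src G V X a, tgt a, wt a).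
have cardK X i j g : #|[pred a | @key X a == (i, j, g)]| = #|arrows X i j g|.
  by apply: eq_card => a; rewrite !inE /key !xpair_eqE andbA.
have [[[i j] g]|f f_bij key_f] := @fiber_bijection _ _ _ (@key Q) (@key P).
  by rewrite !cardK.
by exists f; split=> // a; case: (key_f a).
Qed.

Lemma wq_iso_trans Q1 Q2 Q3 : wq_iso Q1 Q2 -> wq_iso Q2 Q3 -> wq_iso Q1 Q3.
Proof.
case=> f [fb fs ft fw] [h [hb hs ht hw]]; exists (h \o f).
split; first exact: bij_comp.
- by move=> a; rewrite /= hs fs.
- by move=> a; rewrite /= ht ft.
by move=> a; rewrite /= hw fw.
Qed.

Lemma card_hom_del Q (a b : arrow Q) i j g : a <> b ->
  #|arrows Q i j g| =
    (#|arrows (wq_del a b) i j g| +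
       (a \in arrows Q i j g) + (b \in arrows Q i j g))%N.
Proof.
move=> /eqP neq_ab; pose U : finType := {x : arrow Q | x \notin [:: a; b]}.
have del_ab : #|arrows Q i j g :\ a :\ b| = #|arrows (wq_del a b) i j g|.
  rewrite -(card_imset _ (@val_inj _ _ U)); apply: eq_card => x.
  rewrite !inE; apply/idP/imsetP => [/and3P[xb xa hx] | [[y yab] hy ->]].
    have xab : x \notin [:: a; b] by rewrite mem_seq2 negb_or xa xb.
    by exists (exist _ x xab) => //; rewrite inE.
  have [ya yb] : y != a /\ y != b by have:= yab; rewrite mem_seq2 => /norP.
  by move: hy; rewrite !inE /= ya yb.
rewrite (cardsD1 a) (cardsD1 b (_ :\ _)) del_ab in_setD1 eq_sym neq_ab /=.
by rewrite addnA addnC addnA.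
Qed.

Lemma cancelling_hom Q (a b : arrow Q) i j g : cancelling a b ->
  (a \in arrows Q i j g) = (b \in arrows Q j i (g^-1)%g).
Proof.
case=> _ tas tbs wab; rewrite !inE tas tbs andbCA.
have -> : wt b = ((wt a)^-1)%g by rewrite -(mulKg (wt a) (wt b)) wab mulg1.
by rewrite (inj_eq invg_inj).
Qed.

Lemma cancelling_sym Q (a b : arrow Q) : cancelling a b -> cancelling b a.
Proof.
case=> neq_ab tas tbs wab; split=> //; first by move/esym.
by rewrite -(mulKg (wt a) (wt b)) wab mulg1 mulVg.
Qed.

Lemma excess_del Q (a b : arrow Q) i j g : cancelling a b ->
  excess (wq_del a b) i j g = excess Q i j g.
Proof.
move=> ab; have neq_ab : a <> b by case: ab.
rewrite /excess !(card_hom_del _ _ _ neq_ab).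
rewrite -(cancelling_hom _ _ _ ab) -(cancelling_hom _ _ _ (cancelling_sym ab)).
by rewrite -!addnA [((b \in _) + _)%N]addnC subnDr.
Qed.

(** Loops are excluded because a loop of weight g with g^2 = 1 is counted on
    both sides of its own excess, but does not cancel with itself. *)
Lemma card_hom_reduces_to Q P i j g : reduces_to Q P -> no_loops Q ->
  #|arrows P i j g| = excess Q i j g.
Proof.
move=> redQP; elim: redQP => {Q P} [Q irrQ | Q a b P ab _ IH] nlQ; last first.
  by rewrite -(excess_del _ _ _ ab); apply: IH => x; apply: nlQ.
rewrite /excess; have [->|] := posnP #|arrows Q i j g|; first by rewrite sub0n.
case/card_gt0P=> a ha; suff -> : #|arrows Q j i g^-1%g| = 0%N by rewrite subn0.
apply: eq_card0 => b; apply/negP => hb; case: (irrQ a b).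
move: ha hb; rewrite !inE => /and3P[/eqP sa /eqP ta /eqP wa].
case/and3P=> /eqP sb /eqP tb /eqP wb.
split; rewrite ?ta ?sb ?tb ?sa ?wa ?wb ?mulgV // => eq_ab.
by apply: (nlQ a); rewrite ta -sb eq_ab.
Qed.

Lemma reduction_exists Q : exists P, reduces_to Q P.
Proof.
have [n] := ubnP #|arrow Q|; elim: n Q => // n IH Q ltQn.
pose c (ab : arrow Q * arrow Q) := [&& ab.1 != ab.2, tgt ab.1 == src ab.2,
  tgt ab.2 == src ab.1 & (wt ab.1 * wt ab.2 == 1)%g].
have cP a b : reflect (cancelling a b) (c (a, b)).
  apply: (iffP and4P) => [] [/eqP ? /eqP ? /eqP ? /eqP ?] //.
case: (pickP c) => [[a b] /cP ab | irrQ]; last first.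
  by exists Q; apply: reduces_stop => a b /cP; rewrite irrQ.
have [|P redP] := IH (wq_del a b).
  apply: leq_trans (_ : #|arrow Q| <= n)%N => //.
  rewrite card_sig -[X in (_ < X)%N](cardC [pred x | x \notin [:: a; b]]).
  rewrite -[X in (X < _)%N]addn0 ltn_add2l; apply/card_gt0P; exists a.
  by rewrite !inE eqxx.
by exists P; apply: reduces_step ab redP.
Qed.

End WeightReduction.

(** * The rank of adjoint maps *)

(** Transposition does not increase the rank.  Let X_1, ..., X_r be a basis of
    the image of [g].  Testing the adjunction on the standard basis vectors and
    expanding their images under [g] along X gives f(x) = sum_s <x, X_s> w_s,
    where w_s lists the s-th coordinates of these images; thus r vectors w_s
    span the image of [f]. *)
Lemma leq_dim_limg_adjoint (F : fieldType) (I : finType)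
    (f g : 'End({ffun I -> F^o})) :
  (forall x y : {ffun I -> F^o},
     \sum_a (f x a : F) * y a = \sum_a (x a : F) * g y a) ->
  (\dim (limg f) <= \dim (limg g))%N.
Proof.
move=> adj_fg; pose X := vbasis (limg g).
pose delta b : {ffun I -> F^o} := [ffun x => (x == b)%:R].
pose w s : {ffun I -> F^o} := [ffun b => coord X s (g (delta b))].
have sub_fw : (limg f <= <<[seq w s | s <- enum 'I_(\dim (limg g))]>>)%VS.
  apply/subvP => _ /memv_imgP[x _ ->].
  have -> : f x =
      \sum_(s < \dim (limg g)) (\sum_a (x a : F) * X`_s a : F) *: w s.
    apply/ffunP => b.
    have -> : f x b = \sum_a (f x a : F) * delta b a.
      rewrite (bigD1 b) //= ffunE eqxx mulr1 big1 ?addr0 // => a /negPf neq_ab.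
      by rewrite ffunE neq_ab mulr0.
    rewrite adj_fg.
    have Xg : g (delta b) =
        \sum_(s < \dim (limg g)) coord X s (g (delta b)) *: X`_s.
      by apply: coord_vbasis; rewrite memv_img ?memvf.
    rewrite {1}Xg sum_ffunE.
    under eq_bigr do rewrite sum_ffunE mulr_sumr.
    rewrite exchange_big; apply: eq_bigr => s _ /=.
    rewrite !ffunE /GRing.scale /= mulr_suml; apply: eq_bigr => a _.
    by rewrite !ffunE /GRing.scale /= mulrA mulrAC.
  apply: memv_suml => s _.
  by rewrite memvZ // memv_span // map_f // mem_enum.
apply: leq_trans (dimvS sub_fw) _; apply: leq_trans (dim_span _) _.
by rewrite size_map size_enum_ord.
Qed.

(** * Arrows of the reduced part *)

Section ReducedPart.
Variables (F : fieldType) (G : groupType) (V : finType) (Q : wquiver G V).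
Implicit Types (T : pathalg F Q) (A : {set arrow Q}) (i j : V) (g : G).

Lemma arrow_vec_sum A (c : arrow Q -> F) b :
  (\sum_(a in A) c a *: arrow_vec F a) b = if b \in A then c b else 0.
Proof.
rewrite sum_ffunE; case: ifPn => Ab.
  rewrite (bigD1 b) //= !ffunE eqxx [_ *: _]mulr1 big1 ?addr0 // => a.
  case/andP=> _ /negPf neq_ab; rewrite !ffunE eq_sym neq_ab; exact: mulr0.
rewrite big1 // => a Aa; rewrite !ffunE.
case: eqP Ab Aa => [-> /negPf-> //|_ _ _].
exact: mulr0.
Qed.

Lemma dim_span_hom i j g : \dim (span_hom F Q i j g) = #|arrows Q i j g|.
Proof.
rewrite /span_hom; set A := arrows Q i j g.
suff /eqP -> : free [seq arrow_vec F a | a <- enum A].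
  by rewrite size_map -cardE.
change (is_true (free (map_tuple (@arrow_vec F G V Q) (enum_tuple A)))).
apply/freeP => c sum0 s.
have /ffunP/(_ (tnth (enum_tuple A) s)) := sum0.
rewrite sum_ffunE (bigD1 s) //= big1 => [|t neq_ts].
  rewrite addr0 !ffunE -tnth_nth tnth_map ffunE eqxx => <-; exact/esym/mulr1.
rewrite ffunE -tnth_nth tnth_map ffunE.
rewrite (inj_eq (tuple_uniqP _ (enum_uniq A))) eq_sym (negPf neq_ts).
exact: mulr0.
Qed.

Lemma contract_linear T i j g : linear (contract T i j g).
Proof.
move=> c x y; apply/ffunP => a; rewrite !ffunE !arrow_vec_sum.
case: ifP => _; last by rewrite addr0; exact/esym/mulr0.
rewrite /GRing.scale /= mulr_sumr -big_split; apply: eq_bigr => b _ /=.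
by rewrite !ffunE mulrDr mulrCA.
Qed.

Lemma coef2C T a b : coef2 T a b = coef2 T b a.
Proof. exact: addrC. Qed.

(** The form [coef2] is symmetric, so the contractions of T_g^{ij} on either
    side are adjoint to each other for the standard pairing. *)
Lemma leq_dim_triv_part T i j g :
  (\dim (triv_part T i j g) <= \dim (triv_part T j i (g^-1)%g))%N.
Proof.
pose lin i j g : {linear _ -> _} :=
  HB.pack (contract T i j g)
    (GRing.isLinear.Build _ _ _ _ _ (contract_linear T i j g)).
apply: leq_dim_limg_adjoint => x y.
rewrite (lfunE (lin i j g)) (lfunE (lin j i _)) /=.
have sum_hom h i' j' g' (z : arrow_span F Q) :
    \sum_a (if a \in arrows Q i' j' g' then h a else 0) * z a =
    \sum_(a in arrows Q i' j' g') h a * (z a : F).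
  rewrite [RHS]big_mkcond; apply: eq_bigr => a _.
  by case: ifP => // _; rewrite mul0r.
under eq_bigr do rewrite arrow_vec_sum.
under [RHS]eq_bigr do rewrite arrow_vec_sum mulrC.
rewrite !sum_hom invgK.
under eq_bigr do rewrite mulr_suml.
rewrite exchange_big; apply: eq_bigr => b _ /=; rewrite mulr_suml.
by apply: eq_bigr => a _; rewrite coef2C mulrAC.
Qed.

Lemma dim_triv_part_sym T i j g :
  \dim (triv_part T i j g) = \dim (triv_part T j i (g^-1)%g).
Proof.
apply/eqP; rewrite eqn_leq leq_dim_triv_part /=.
by have:= leq_dim_triv_part T j i (g^-1)%g; rewrite invgK.
Qed.

Lemma card_hom_red_basis T (P : wquiver G V)
    (iota : arrow P -> arrow_span F Q) i j g :
  red_basis T iota ->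
  (#|arrows P i j g| + \dim (triv_part T i j g))%N = #|arrows Q i j g|.
Proof.
move=> /(_ i j g) [/eqP dimX sumX capX]; rewrite -dim_span_hom -sumX.
by rewrite dimv_disjoint_sum // dimX size_map -cardE addnC.
Qed.

End ReducedPart.

(** * Comparison of the two mutations *)

(** A composite arrow [ab] that is a loop comes from an oriented 2-cycle. *)
Lemma no_loops_premut (G : groupType) (V : finType) (Q : wquiver G V) k :
  no_loops Q -> no_2cycles Q -> no_loops (wq_premut k Q).
Proof.
move=> nl n2 [a|[[a b] /= ab]] /=.
  by case: ifP => _; [move/esym |]; apply: nl.
case/andP: ab => /= /eqP ta /eqP sb eq_ab.
by apply: (n2 a b); split=> //; rewrite ta sb.
Qed.

Theorem proposition3p2p2 (R : realType) (G : groupType) (V : finType)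
  (M : wqp R[i] G V) (k : V) (M' : wqp R[i] G V) :
  no_loops (quiver M) -> no_2cycles (quiver M) ->
  wqp_mutation k M M' ->
  (forall P : wquiver G V,
     wq_mutation k (quiver M) P -> weight_reduction (quiver M') P) /\
  (no_2cycles (quiver M') ->
   forall P : wquiver G V,
     wq_mutation k (quiver M) P -> wq_iso (quiver M') P).
Proof.
move=> nlQ n2Q [S [_ _ _ [iota [_ [basis_iota _ _ _]]]]].
set Q := quiver M in nlQ n2Q S iota basis_iota *.
set Q' := quiver M' in iota basis_iota *.
have nlB : no_loops (wq_premut k Q) by apply: no_loops_premut.
have card_hom := card_hom_red_basis _ _ _ basis_iota.
have nlQ' : no_loops Q'.
  apply: no_loops_card_hom => i g; apply/eqP; rewrite -leqn0.
  by rewrite -(card_hom_loop i g nlB) -card_hom leq_addr.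
have eq_excess i j g : excess Q' i j g = excess (wq_premut k Q) i j g.
  by rewrite /excess -!card_hom [in RHS]dim_triv_part_sym subnDr.
have iso_red P P' : wq_mutation k Q P -> reduces_to Q' P' -> wq_iso P' P.
  case=> P0 redP0 isoP0 redP'; apply: wq_iso_trans isoP0.
  apply: eq_hom_iso => i j g; rewrite (card_hom_reduces_to _ _ _ redP' nlQ').
  by rewrite (card_hom_reduces_to _ _ _ redP0 nlB) eq_excess.
split=> [P mutP | n2Q' P mutP].
  have [P' redP'] := reduction_exists Q'.
  by exists P' => //; apply: iso_red mutP redP'.
apply: iso_red mutP _; apply: reduces_stop => a b [_ ta tb _].
by apply: (n2Q' a b); split=> //; apply: nlQ'.
Qed.
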